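(* For every $k\in\mathbb{N}$ and every $x\in\mathbb{C}$ with $|x|\leq 1$, $$ \sum_{\nu=2}^{k+1} \nu\sum_{m\geq 1,\, n\geq 1}\frac{x^n}{n^{k+2-\nu}(m+n)^{\nu+1}}+ (k+1)\sum_{m\geq 1,\, n\geq 1}\frac{x^n}{m(m+n)^{k+2}}+\sum_{m\geq 1,\, n\geq 1}\frac{x^n}{m^2(m+n)^{k+1}}-\sum_{m\geq 1,\, n\geq 1}\frac{x^{m+n}}{m^2(m+n)^{k+1}}=\sum_{n\geq 1} \frac{x^n}{n^{k+3}}. $$
   Context: $\mathbb{N}$ is the set of positive integers; the summation variables $m,n$ run over positive integers. *)

(* Defs.v *)
From mathcomp Require Import all_boot all_order all_algebra.
From mathcomp Require Import all_classical all_reals all_analysis.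
From mathcomp.analysis.showcase Require summability.
From mathcomp.real_closed Require Export complex.

Set Implicit Arguments.
Unset Strict Implicit.
Unset Printing Implicit Defensive.

Import Order.TTheory GRing.Theory Num.Theory.
Import numFieldNormedType.Exports.

Local Open Scope classical_set_scope.
Local Open Scope ring_scope.

(* Double series over positive integers m, n are unordered sums: limits of
   partial sums along the directed set of finite sets of index pairs. In R[i]
   their convergence is equivalent to absolute convergence. A pair (a, b) of
   naturals encodes (m, n) = (a + 1, b + 1). The type R[i]^o (rather than R[i])
   carries the normed-module structure given by the modulus. *)

Definition shift_pair (T : Type) (F : nat -> nat -> T) (p : nat * nat) : T :=
  F p.1.+1 p.2.+1.

Definition dsum_cvg (R : realType) (F : nat -> nat -> R[i]) : Prop :=
  cvg (summability.partial_sum (shift_pair F : nat * nat -> R[i]^o)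
         @ summability.totally).

Definition dsum (R : realType) (F : nat -> nat -> R[i]) : R[i] :=
  summability.sum (shift_pair F : nat * nat -> R[i]^o).

Definition ssum_cvg (R : realType) (F : nat -> R[i]) : Prop :=
  cvgn (fun N => \sum_(1 <= n < N) F n : R[i]^o).

Definition ssum (R : realType) (F : nat -> R[i]) : R[i] :=
  \big[+%R/0 : R[i]^o]_(1 <= n <oo) F n.

(* Main.v *)
(* Partial fractions in m turn the coefficient of x^n in the first three sums
   into (1 / m^2 - 1 / (m+n)^2) / n^(k+1), so that these sums add up to the
   double sum of A(m, n) = x^n / (m^2 n^(k+1)) minus that of A(m+n, n). The
   latter is the part m > n of the sum of A; the part m < n is the sum of
   A(m, m+n), i.e. the fourth sum, and the diagonal is the sum of
   x^n / n^(k+3). All the terms are dominated by 1 / (m^2 n^2). *)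

Require Import Defs.
From mathcomp Require Import all_boot all_order all_algebra finmap.
From mathcomp Require Import all_classical all_reals all_analysis.
From mathcomp Require Import ring lra zify.

Set Implicit Arguments.
Unset Strict Implicit.
Unset Printing Implicit Defensive.

Import Order.TTheory GRing.Theory Num.Theory.
Import numFieldNormedType.Exports.

Local Open Scope ring_scope.

(* Unordered sums over an arbitrary index type in a normed module *)
#[local] Existing Instance summability.totally_filter.

(** A relation rather than a function: [summability.sum] is a limit and takes a default value when
    the sum does not converge. *)
Definition has_sum (I : choiceType) (K : numFieldType) (V : normedModType K)
    (f : I -> V) (l : V) : Prop :=
  (summability.partial_sum f @ summability.totally --> l)%classic.

Lemma big_fset_iota (V : zmodType) N (f : nat -> V) :
  \sum_(n <- [fset n | n in index_iota 0 N]%fset) f n = \sum_(0 <= n < N) f n.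
Proof.
rewrite eq_big_imfset // map_id; apply: congr_big => //.
by apply: undup_id; apply: iota_uniq.
Qed.

Section HasSum.
Variables (K : numFieldType) (V : normedModType K).
Implicit Types (I J : choiceType) (l : V).

Lemma partial_sumE I (f : I -> V) (A : {fset I}) :
  summability.partial_sum f A = \sum_(i <- A) f i.
Proof. by rewrite big_seq_fsetE. Qed.

Lemma has_sumP I (f : I -> V) l :
  has_sum f l <-> forall e : K, 0 < e -> exists A : {fset I},
    forall B : {fset I}, (A `<=` B)%fset -> `|l - \sum_(i <- B) f i| < e.
Proof.
rewrite /has_sum; split=> [/cvgrPdist_lt fl e e0|fl].
  have [A _ AP] := fl e e0; exists A => B AB.
  by rewrite -partial_sumE; apply: AP.
apply/cvgrPdist_lt => e e0; have [A AP] := fl e e0.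
by exists A => // B AB; rewrite /= partial_sumE; apply: AP.
Qed.

Lemma has_sum_lim I (f : I -> V) l : has_sum f l -> summability.sum f = l.
Proof. by move=> fl; apply: cvg_lim. Qed.

Lemma has_sum_unique I (f : I -> V) l l' :
  has_sum f l -> has_sum f l' -> l = l'.
Proof. by move=> /has_sum_lim <- /has_sum_lim. Qed.

Lemma eq_has_sum I (f g : I -> V) l : f =1 g -> has_sum f l -> has_sum g l.
Proof. by move=> /funext ->. Qed.

Lemma has_sum0 I : has_sum (fun _ : I => 0 : V) 0.
Proof.
apply/has_sumP => e e0; exists fset0 => B _.
by rewrite big1 // subrr normr0.
Qed.

Lemma has_sumD I (f g : I -> V) l l' :
  has_sum f l -> has_sum g l' -> has_sum (fun i => f i + g i) (l + l').
Proof.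
move=> fl gl; rewrite /has_sum.
have -> : summability.partial_sum (fun i => f i + g i) =
    (fun A => summability.partial_sum f A + summability.partial_sum g A).
  by apply/funext => A; rewrite !partial_sumE big_split.
exact: cvgD.
Qed.

Lemma has_sumZ I (a : K) (f : I -> V) l :
  has_sum f l -> has_sum (fun i => a *: f i) (a *: l).
Proof.
move=> fl; rewrite /has_sum.
have -> : summability.partial_sum (fun i => a *: f i) =
    (fun A => a *: summability.partial_sum f A).
  by apply/funext => A; rewrite !partial_sumE scaler_sumr.
exact: cvgZr.
Qed.

Lemma has_sumB I (f g : I -> V) l l' :
  has_sum f l -> has_sum g l' -> has_sum (fun i => f i - g i) (l - l').
Proof.
move=> fl gl; have := has_sumD fl (has_sumZ (a := -1) gl); rewrite scaleN1r.
by apply: eq_has_sum => i; rewrite scaleN1r.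
Qed.

Lemma has_sum_sum I (T : eqType) (s : seq T) (f : T -> I -> V) (l : T -> V) :
  (forall t, t \in s -> has_sum (f t) (l t)) ->
  has_sum (fun i => \sum_(t <- s) f t i) (\sum_(t <- s) l t).
Proof.
elim: s => [_|t s IHs fl].
  by rewrite big_nil; apply: eq_has_sum (has_sum0 I) => i; rewrite big_nil.
rewrite big_cons.
have := has_sumD (fl t (mem_head _ _))
  (IHs (fun u us => fl u (mem_behead (s := t :: s) us))).
by apply: eq_has_sum => i; rewrite big_cons.
Qed.

(** Since [f] vanishes off the image of [h], its sum over a finite set [B] is the sum of [f \o h]
    over the preimage of [B], and this preimage contains [A] as soon as [B] contains the image of
    [A]. *)
Lemma has_sum_inj I J (h : J -> I) (f : I -> V) l :
  injective h -> (forall i, (forall j, h j <> i) -> f i = 0) ->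
  has_sum (f \o h) l -> has_sum f l.
Proof.
move=> hI f0 /has_sumP fhl; apply/has_sumP => e /fhl [A AP].
exists [fset h j | j in A]%fset => B AB.
(* [B'] is the preimage of [B]: each element of [B] in the image of [h] is sent to a chosen
   preimage, unique by injectivity, and the others are dropped. *)
pose B' := [fset j | j in pmap (fun i =>
  if pselect (exists j, h j = i) is left p then Some (projT1 (cid p)) else None)
  B]%fset.
have B'P j : (j \in B') = (h j \in B).
  rewrite !inE /= mem_pmap; apply/mapP/idP => [[i iB]|hjB].
    by case: pselect => // -[j' hj'] [->]; case: cid => ? /= ->.
  exists (h j) => //; case: pselect => [p|[]]; last by exists j.
  by congr Some; case: cid => ? /= /hI.
have -> : \sum_(i <- B) f i = \sum_(j <- B') (f \o h) j.
  transitivity (\sum_(i <- [fset h j | j in B']%fset) f i); last first.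
    by rewrite big_imfset //= => ? ? _ _ /hI.
  symmetry; apply: big_fset_incl.
    by apply/fsubsetP => i /imfsetP [j /=]; rewrite B'P => ? ->.
  move=> i iB /imfsetP ni; apply: f0 => j hji; apply: ni; exists j => //=.
  by rewrite B'P hji.
apply: AP; apply/fsubsetP => j jA; rewrite B'P.
by apply: (fsubsetP AB); apply/imfsetP; exists j.
Qed.

(** Every finite set of naturals lies in an initial segment. The summation range [1 <= n < N]
    corresponds to the shifted indices below [N.-1], hence the two successors in the witness. *)
Lemma has_sum_series (f : nat -> V) l :
  has_sum (f \o S) l -> ((fun N => \sum_(1 <= n < N) f n) @ \oo --> l)%classic.
Proof.
move=> /has_sumP fl; apply/cvgrPdist_lt => e /fl [A AP].
exists (\max_(i <- A) i.+1).+1%N => // N /= AN.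
have := AP [fset n | n in index_iota 0 N.-1]%fset.
rewrite big_add1 big_fset_iota; apply.
apply/fsubsetP => i iA; rewrite !inE mem_index_iota /=.
case: N AN => // N; rewrite ltnS; apply: leq_trans.
by rewrite (bigD1_seq i) //= leq_maxl.
Qed.

End HasSum.

(** * Convergence by domination, for real and complex terms *)

Section Domination.
Variable R : realType.
Implicit Type I : choiceType.

Lemma ler_sum_fsubset I (f : I -> R) (A B : {fset I}) :
  (forall i, 0 <= f i) -> (A `<=` B)%fset ->
  \sum_(i <- A) f i <= \sum_(i <- B) f i.
Proof.
move=> f0 AB; rewrite [leRHS](big_fsetID _ (mem A)) /= -[leLHS]addr0.
rewrite lerD ?sumr_ge0 // le_eqVlt; apply/orP/or_introl/eqP.
apply: eq_fbigl => i; rewrite !inE /=.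
by case: (boolP (i \in A)) => [/(fsubsetP AB)->|]; rewrite ?andbF.
Qed.

(** The sum is the supremum of the finite partial sums: once one of them is within [e] of it, so are
    all larger ones, by monotonicity. *)
Lemma has_sum_ge0 I (f : I -> R) M : (forall i, 0 <= f i) ->
  (forall A : {fset I}, \sum_(i <- A) f i <= M) ->
  exists l : R^o, has_sum (f : I -> R^o) l.
Proof.
move=> f0 fM; pose E := [set \sum_(i <- A) f i | A in [set: {fset I}]]%classic.
have supE : has_sup E.
  split; first by exists (\sum_(i <- fset0) f i), fset0.
  by exists M => _ [A _ <-].
exists (sup E); apply/has_sumP => e e0.
have [_ [A _ <-] Ae] := sup_adherent e0 supE; exists A => B AB.
have /ub_le_sup : E (\sum_(i <- B) f i) by exists B.
move=> /(_ supE.2) Bsup; rewrite ger0_norm ?subr_ge0 //.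
by have := ler_sum_fsubset f0 AB; lra.
Qed.

(** Write [f] as [(f + g) - g], a difference of nonnegative families whose partial sums are bounded
    by [M + M] and [M]. *)
Lemma has_sum_dominated I (f g : I -> R) M : (forall i, `|f i| <= g i) ->
  (forall A : {fset I}, \sum_(i <- A) g i <= M) ->
  exists l : R^o, has_sum (f : I -> R^o) l.
Proof.
move=> fg gM.
have g0 i : 0 <= g i by exact: le_trans (fg i).
have fgD i : 0 <= f i + g i by have := fg i; rewrite ler_norml; lra.
have [|lg lgP] := has_sum_ge0 g0 (M := M); first exact: gM.
have [A|l lP] := has_sum_ge0 fgD (M := M + M).
  rewrite big_split /= lerD //; apply: le_trans (gM A).
  by apply: ler_sum => i _; apply: le_trans (fg i); apply: ler_norm.
exists (l - lg); apply: eq_has_sum (has_sumB lP lgP) => i.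
exact: addrK.
Qed.

Lemma has_sum_complex I (f : I -> R[i]) (a b : R^o) :
  has_sum (fun i => complex.Re (f i) : R^o) a ->
  has_sum (fun i => complex.Im (f i) : R^o) b ->
  has_sum (f : I -> R[i]^o) (Complex a b).
Proof.
move=> /has_sumP fa /has_sumP fb; apply/has_sumP => e.
(* In the order of [R[i]], a positive [e] has zero imaginary part, so the tolerance is a positive
   real; half of it goes to each coordinate. *)
case: e => e e'; rewrite ltcE /= => /andP[/eqP -> e0].
have e20 : 0 < e / 2 by lra.
have [A AP] := fa _ e20; have [B BP] := fb _ e20.
exists (A `|` B)%fset => C; rewrite fsubUset => /andP[/AP Ca /BP Cb].
have normc_le (u v : R) : `|Complex u v| <= (`|u| + `|v|)%:C%C.
  have -> : Complex u v = u%:C%C + 'i%C * v%:C%C by rewrite [LHS]complexE.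
  rewrite (le_trans (ler_normD _ _)) // normrM !complex.normc_def /=.
  by rewrite !expr0n /= !addr0 add0r expr1n !sqrtr_sqr sqrtr1 mul1r raddfD.
have -> : \sum_(i <- C) f i =
    Complex (\sum_(i <- C) complex.Re (f i)) (\sum_(i <- C) complex.Im (f i)).
  elim/big_rec3: _ => //= i x y z _ ->.
  by case: (f i).
apply: le_lt_trans (normc_le _ _) _.
by rewrite ltcR /=; lra.
Qed.

Lemma has_sum_dominatedC I (f : I -> R[i]) (g : I -> R) M :
  (forall i, `|f i| <= (g i)%:C%C) ->
  (forall A : {fset I}, \sum_(i <- A) g i <= M) ->
  exists l : R[i]^o, has_sum (f : I -> R[i]^o) l.
Proof.
move=> fg gM.
have [||a aP] := @has_sum_dominated I (fun i => complex.Re (f i)) g M => //.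
  move=> i; have := fg i; rewrite complex.normc_def lecR; apply: le_trans.
  by rewrite -sqrtr_sqr ler_wsqrtr // lerDl sqr_ge0.
have [||b bP] := @has_sum_dominated I (fun i => complex.Im (f i)) g M => //.
  move=> i; have := fg i; rewrite complex.normc_def lecR; apply: le_trans.
  by rewrite -sqrtr_sqr ler_wsqrtr // lerDr sqr_ge0.
by exists (Complex a b); apply: has_sum_complex.
Qed.

Lemma sum_inv_sqr_le (A : {fset nat}) :
  \sum_(n <- A) (n.+1%:R ^+ 2)^-1 <= 2 :> R.
Proof.
(* The term [- N.+1%:R^-1] makes the induction go through: with [y = N + 1], the step has slack
   exactly [1 / (y * (y + 1) ^ 2)]. *)
have telescope N :
    \sum_(0 <= n < N.+1) (n.+1%:R ^+ 2)^-1 <= 2 - N.+1%:R^-1 :> R.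
  elim: N => [|N IHN]; first by rewrite big_nat1 expr1n invr1; lra.
  rewrite big_nat_recr //= (le_trans (lerD IHN (lexx _))) //.
  have : 0 < N.+1%:R :> R by [].
  rewrite -[N.+2%:R]natr1; set y := N.+1%:R => y0.
  rewrite -subr_ge0.
  have -> : 2 - (y + 1)^-1 - (2 - y^-1 + ((y + 1) ^+ 2)^-1)
    = (y * (y + 1) ^+ 2)^-1 :> R by field; lra.
  by rewrite invr_ge0; nra.
pose N := \max_(n <- A) n.
have AN : (A `<=` [fset n | n in index_iota 0 N.+1])%fset.
  apply/fsubsetP => i iA; rewrite in_fset /= mem_index_iota ltnS.
  by rewrite /N (bigD1_seq i) //= leq_maxl.
apply: le_trans (ler_sum_fsubset _ AN) _ => [n|].
  by rewrite invr_ge0 exprn_ge0.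
rewrite big_fset_iota.
by apply: le_trans (telescope N) _; rewrite gerBl invr_ge0.
Qed.

(** Enlarge [A] to the product of its two projections; there the sum factors into two sums, each at
    most 2. *)
Lemma sum_inv_sqr_pair_le (A : {fset nat * nat}) :
  \sum_(p <- A) (p.1.+1%:R ^+ 2 * p.2.+1%:R ^+ 2)^-1 <= 4 :> R.
Proof.
pose B := [fset p.1 | p in A]%fset; pose C := [fset p.2 | p in A]%fset.
have ABC : (A `<=` B `*` C)%fset.
  apply/fsubsetP => -[m n] mnA; rewrite in_fsetM /=.
  by apply/andP; split; apply/imfsetP; exists (m, n).
apply: le_trans (ler_sum_fsubset _ ABC) _ => [p|].
  by rewrite invr_ge0 mulr_ge0 ?exprn_ge0.
have -> : \sum_(p <- (B `*` C)%fset) (p.1.+1%:R ^+ 2 * p.2.+1%:R ^+ 2)^-1 =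
    (\sum_(m <- B) (m.+1%:R ^+ 2)^-1) * (\sum_(n <- C) (n.+1%:R ^+ 2)^-1) :> R.
  rewrite big_imfset2 /=; last by move=> [m n] [m' n'] _ _ /= [-> ->].
  rewrite mulr_suml; apply: eq_bigr => m _.
  by rewrite mulr_sumr; apply: eq_bigr => n _; rewrite invfM.
rewrite (_ : 4 = 2 * 2); last by rewrite -natrM.
rewrite ler_pM ?sum_inv_sqr_le ?sumr_ge0 // => i _;
  by rewrite invr_ge0 exprn_ge0.
Qed.

End Domination.

(** * Partial fractions, comparison of denominators, and splitting a double sum by the order of its
    indices *)

Lemma sum_partial_fractions (K : fieldType) (k : nat) (m n : K) :
  m != 0 -> n != 0 -> m + n != 0 ->
  \sum_(2 <= nu < k.+2) nu%:R / (n ^+ (k + 2 - nu) * (m + n) ^+ nu.+1)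
  + (k + 1)%:R / (m * (m + n) ^+ (k + 2)) + (m ^+ 2 * (m + n) ^+ (k + 1))^-1
  = ((m ^+ 2)^-1 - ((m + n) ^+ 2)^-1) / n ^+ (k + 1).
Proof.
(* Dividing the identity for [k] by [n] turns its sum into the one for [k.+1] without the last term
   [nu = k.+2], in which [n] has exponent 1. *)
move=> m0 n0 b0; elim: k => [|k IHk].
  rewrite big_geq // !add0n expr1 add0r.
  by field; rewrite m0 n0 b0.
rewrite big_nat_recr //=.
have -> : \sum_(2 <= nu < k.+2) nu%:R / (n ^+ (k.+1 + 2 - nu) * (m + n) ^+ nu.+1)
    = (\sum_(2 <= nu < k.+2) nu%:R / (n ^+ (k + 2 - nu) * (m + n) ^+ nu.+1)) / n.
  rewrite mulr_suml; apply: eq_big_nat => nu /andP[_ nuk].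
  rewrite addSn subSn; last by rewrite addn2 ltnW.
  by rewrite exprS -(mulrA n) invfM mulrCA mulrC.
have -> : (k.+1 + 2 - k.+2 = 1)%N by rewrite addn2 subSn // subnn.
move: IHk => /(congr1 (fun u => u / n)).
rewrite !addn1 !addn2 !exprS expr0 -[k.+2%:R]natr1.
set s := \sum_(_ <= _ < _) _; set u := _ ^+ k; set v := n ^+ k => IHk.
have u0 : u != 0 by rewrite expf_neq0.
have v0 : v != 0 by rewrite expf_neq0.
(* Solving the induction hypothesis for [s / n] eliminates the sum and leaves a rational identity in
   [m], [n] and the nonzero powers [u], [v]. *)
have -> : s / n = ((m * (m * 1))^-1 - ((m + n) * ((m + n) * 1))^-1) / (n * v) / n
    - (k.+1%:R / (m * ((m + n) * ((m + n) * u)))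
        + (m * (m * 1) * ((m + n) * u))^-1) / n.
  rewrite -IHk; ring.
by field; rewrite m0 n0 b0 u0 v0.
Qed.

(** One bound for all the double series, used with [m] and [n] exchanged where needed. If [c >= 3],
    already [n * (m + n) ^ 3] is large enough; otherwise [c = 2], so [a >= 2], and
    [n ^ 2 * (m + n) ^ 2] is. *)
Lemma sqr_mul_le (m n a c : nat) : (0 < m)%N -> (0 < n)%N ->
  (0 < a)%N -> (1 < c)%N -> (3 < a + c)%N ->
  (m ^ 2 * n ^ 2 <= n ^ a * (m + n) ^ c)%N.
Proof.
move=> m0 n0 a0 c1 ac.
have [c2|c2] := ltnP 2 c.
  apply: (@leq_trans (n ^ 1 * (m + n) ^ 3)); first by rewrite expn1; nia.
  by rewrite leq_mul // leq_pexp2l // addn_gt0 m0.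
apply: (@leq_trans (n ^ 2 * (m + n) ^ 2)); first by rewrite mulnC; nia.
by rewrite leq_mul // leq_pexp2l ?addn_gt0 ?m0 //; lia.
Qed.

(** The regions m > n, m < n and m = n are parametrized injectively by (m + n, n), (m, m + n) and
    (n, n). Each restriction of [F], extended by zero, is summed by [has_sum_inj], and the three
    restrictions add up to [F]. *)
Lemma has_sum_trichotomy (K : numFieldType) (V : normedModType K)
    (F : nat -> nat -> V) (a b c : V) :
  has_sum (shift_pair (fun m n => F (m + n)%N n)) a ->
  has_sum (shift_pair (fun m n => F m (m + n)%N)) b ->
  has_sum ((fun n => F n n) \o S) c ->
  has_sum (shift_pair F) (a + b + c).
Proof.
move=> Fa Fb Fc.
pose G (r : rel nat) (p : nat * nat) : V :=
  if r p.1 p.2 then shift_pair F p else 0.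
have Ga : has_sum (G (fun m n => n < m)%N) a.
  (* The successor comes from the encoding: [p] stands for [(p.1 + 1, p.2 + 1)], so m + n is encoded
     by [(p.1 + p.2).+1]. *)
  apply: (has_sum_inj (h := fun p : nat * nat => ((p.1 + p.2).+1, p.2))).
  - by move=> [m n] [m' n'] [] mn nn'; congr pair; lia.
  - move=> [m n] np; rewrite /G /=.
    case: ifP => // nm; case: (np (m - n.+1, n)%N).
    by congr pair => /=; lia.
  apply: eq_has_sum Fa => -[m n]; rewrite /G /= ifT; last by lia.
  by rewrite /shift_pair /= addSn addnS.
have Gb : has_sum (G (fun m n => m < n)%N) b.
  apply: (has_sum_inj (h := fun p : nat * nat => (p.1, (p.1 + p.2).+1))).
  - by move=> [m n] [m' n'] [] mn nn'; congr pair; lia.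
  - move=> [m n] np; rewrite /G /=.
    case: ifP => // nm; case: (np (m, n - m.+1)%N).
    by congr pair => /=; lia.
  apply: eq_has_sum Fb => -[m n]; rewrite /G /= ifT; last by lia.
  by rewrite /shift_pair /= addSn addnS.
have Gc : has_sum (G (fun m n => m == n)) c.
  apply: (has_sum_inj (h := fun n : nat => (n, n))).
  - by move=> m n [].
  - move=> [m n] np; rewrite /G /=.
    by case: eqP => // nm; case: (np m); rewrite nm.
  by apply: eq_has_sum Fc => n; rewrite /G /= eqxx.
apply: eq_has_sum (has_sumD (has_sumD Ga Gb) Gc) => -[m n]; rewrite /G /=.
by case: ltngtP => _; rewrite ?addr0 ?add0r.
Qed.

(** * From unordered sums to [dsum] and [ssum] *)

Lemma has_sum_dsum (R : realType) (F : nat -> nat -> R[i]) (l : R[i]^o) :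
  has_sum (shift_pair F : _ -> R[i]^o) l ->
  dsum_cvg F /\ has_sum (shift_pair F : _ -> R[i]^o) (dsum F).
Proof.
move=> Fl; split; first by apply/cvg_ex; exists l.
by rewrite /dsum (has_sum_lim Fl).
Qed.

Lemma has_sum_ssum (R : realType) (F : nat -> R[i]) (l : R[i]^o) :
  has_sum (F \o S : nat -> R[i]^o) l ->
  ssum_cvg F /\ has_sum (F \o S : nat -> R[i]^o) (ssum F).
Proof.
move=> Fl; have Fcvg := has_sum_series (V := R[i]^o) Fl.
split; first by apply/cvg_ex; exists l.
suff -> : ssum F = l by [].
exact: (cvg_lim (@norm_hausdorff R[i] R[i]^o) Fcvg).
Qed.

(** * Summability of the power terms in the closed unit disk *)

Section UnitDisk.
Variables (R : realType) (x : R[i]).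
Hypothesis hx : `|x| <= 1.

(** As [|x| <= 1], each term has modulus at most [1 / d i <= 1 / c i], whatever the exponent of
    [x]. *)
Lemma has_sum_pow_div (I : choiceType) (e c d : I -> nat) (M : R) :
  (forall i, 0 < c i <= d i)%N ->
  (forall A : {fset I}, \sum_(i <- A) (c i)%:R^-1 <= M) ->
  exists l : R[i]^o, has_sum (fun i => x ^+ e i / (d i)%:R : R[i]^o) l.
Proof.
move=> cd cM; apply: (has_sum_dominatedC (g := fun i => (c i)%:R^-1)) cM => i.
have /andP[c0 cdi] := cd i.
rewrite normrM normrX normfV normr_nat fmorphV rmorph_nat -[leRHS]mul1r.
rewrite ler_pM ?exprn_ge0 ?invr_ge0 ?exprn_ile1 //.
by rewrite lef_pV2 ?ler_nat ?posrE ?ltr0n // (leq_trans c0).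
Qed.

Lemma has_sum_pow_div_pair (e d : nat -> nat -> nat) :
  (forall m n, 0 < m -> 0 < n -> m ^ 2 * n ^ 2 <= d m n)%N ->
  exists l : R[i]^o,
    has_sum (shift_pair (fun m n => x ^+ e m n / (d m n)%:R) : _ -> R[i]^o) l.
Proof.
move=> cd; apply: (@has_sum_pow_div _ (fun p => e p.1.+1 p.2.+1)
  (fun p => p.1.+1 ^ 2 * p.2.+1 ^ 2)%N (fun p => d p.1.+1 p.2.+1) 4) => [p|A].
  by rewrite muln_gt0 !expn_gt0 /= cd.
under eq_bigr do rewrite natrM !natrX.
exact: sum_inv_sqr_pair_le.
Qed.

End UnitDisk.

(** * Convergence of all the series and the identity between their sums *)

Theorem theorem1p4 (R : realType) (k : nat) (x : R[i])
    (hk : (0 < k)%N) (hx : `|x| <= 1) :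
  [/\ forall nu : nat, (2 <= nu <= k.+1)%N ->
        dsum_cvg (fun m n =>
          x ^+ n / (n%:R ^+ (k + 2 - nu) * (m + n)%:R ^+ nu.+1)),
      dsum_cvg (fun m n => x ^+ n / (m%:R * (m + n)%:R ^+ (k + 2))),
      dsum_cvg (fun m n => x ^+ n / (m%:R ^+ 2 * (m + n)%:R ^+ (k + 1))),
      dsum_cvg (fun m n => x ^+ (m + n) / (m%:R ^+ 2 * (m + n)%:R ^+ (k + 1)))
    & ssum_cvg (fun n => x ^+ n / n%:R ^+ (k + 3))] /\
  \sum_(2 <= nu < k.+2) nu%:R *
      dsum (fun m n => x ^+ n / (n%:R ^+ (k + 2 - nu) * (m + n)%:R ^+ nu.+1))
  + (k + 1)%:R * dsum (fun m n => x ^+ n / (m%:R * (m + n)%:R ^+ (k + 2)))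
  + dsum (fun m n => x ^+ n / (m%:R ^+ 2 * (m + n)%:R ^+ (k + 1)))
  - dsum (fun m n => x ^+ (m + n) / (m%:R ^+ 2 * (m + n)%:R ^+ (k + 1)))
  = ssum (fun n => x ^+ n / n%:R ^+ (k + 3)).
Proof.
have Snu nu : (2 <= nu <= k.+1)%N -> exists l : R[i]^o,
    has_sum (shift_pair (fun m n =>
      x ^+ n / (n%:R ^+ (k + 2 - nu) * (m + n)%:R ^+ nu.+1)) : _ -> R[i]^o) l.
  move=> nuk.
  have [|l lP] := has_sum_pow_div_pair hx (fun _ n => n)
    (d := fun m n => n ^ (k + 2 - nu) * (m + n) ^ nu.+1)%N.
    by move=> m n m0 n0; apply: sqr_mul_le => //; lia.
  by exists l; apply: eq_has_sum lP => p; rewrite /shift_pair natrM !natrX.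
have [|T1 T1P] := has_sum_pow_div_pair hx (fun _ n => n)
    (d := fun m n => m ^ 1 * (n + m) ^ (k + 2))%N.
  by move=> m n m0 n0; rewrite mulnC; apply: sqr_mul_le => //; lia.
have [|T2 T2P] := has_sum_pow_div_pair hx (fun _ n => n)
    (d := fun m n => m ^ 2 * (n + m) ^ (k + 1))%N.
  by move=> m n m0 n0; rewrite mulnC; apply: sqr_mul_le => //; lia.
have [|T3 T3P] := has_sum_pow_div_pair hx (fun m n => m + n)%N
    (d := fun m n => m ^ 2 * (n + m) ^ (k + 1))%N.
  by move=> m n m0 n0; rewrite mulnC; apply: sqr_mul_le => //; lia.
(* [T4], absent from the statement, is the sum of A(m + n, n); it converges because [k >= 1] makes
   the exponent of [n] at least 2. *)
have [|T4 T4P] := has_sum_pow_div_pair hx (fun _ n => n)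
    (d := fun m n => n ^ (k + 1) * (m + n) ^ 2)%N.
  by move=> m n m0 n0; apply: sqr_mul_le => //; lia.
have [n|A|D DP] := @has_sum_pow_div _ _ hx nat S (fun n => n.+1 ^ 2)%N
    (fun n => n.+1 ^ (k + 3))%N 2.
- by rewrite expn_gt0 leq_pexp2l // addn3.
- by under eq_bigr do rewrite natrX; apply: sum_inv_sqr_le.
have [|cD {}DP] := has_sum_ssum (F := fun n => x ^+ n / n%:R ^+ (k + 3)) (l := D).
  by apply: eq_has_sum DP => n /=; rewrite natrX.
have [|c1 {}T1P] := has_sum_dsum (F := fun m n =>
    x ^+ n / (m%:R * (m + n)%:R ^+ (k + 2))) (l := T1).
  apply: eq_has_sum T1P => p.
  by rewrite /shift_pair natrM !natrX expr1 [(p.2.+1 + _)%N]addnC.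
have [|c2 {}T2P] := has_sum_dsum (F := fun m n =>
    x ^+ n / (m%:R ^+ 2 * (m + n)%:R ^+ (k + 1))) (l := T2).
  apply: eq_has_sum T2P => p.
  by rewrite /shift_pair natrM !natrX [(p.2.+1 + _)%N]addnC.
have [|c3 {}T3P] := has_sum_dsum (F := fun m n =>
    x ^+ (m + n) / (m%:R ^+ 2 * (m + n)%:R ^+ (k + 1))) (l := T3).
  apply: eq_has_sum T3P => p.
  by rewrite /shift_pair natrM !natrX [(p.2.+1 + _)%N]addnC.
split.
  split; [by move=> nu /Snu [l] /has_sum_dsum [] | exact: c1 | exact: c2
         | exact: c3 | exact: cD].
set s1 := \sum_(_ <= _ < _) _; set s2 := dsum _; set s3 := dsum _.
set s4 := dsum _; set s5 := ssum _.
(* The sum of [F] is computed twice: [F1] splits it by the order of [m] and [n], [F2] by partial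
   fractions. *)
pose F (m n : nat) := x ^+ n / (n%:R ^+ (k + 1) * m%:R ^+ 2).
have F1 : has_sum (shift_pair F : _ -> R[i]^o) (T4 + s4 + s5 : R[i]^o).
  apply: (has_sum_trichotomy (V := R[i]^o)).
  - by apply: eq_has_sum T4P => p; rewrite /shift_pair natrM !natrX.
  - apply: eq_has_sum T3P => p.
    by rewrite /shift_pair /F mulrC [in RHS]mulrC [_ ^+ 2 * _]mulrC.
  - apply: eq_has_sum DP => n; rewrite /= /F -exprD; congr (_ / _ ^+ _).
    by rewrite -addnA.
have F2 : has_sum (shift_pair F : _ -> R[i]^o)
    (s1 + (k + 1)%:R * s2 + s3 + T4 : R[i]^o).
  pose f nu : nat * nat -> R[i]^o := shift_pair (fun m n =>
    x ^+ n / (n%:R ^+ (k + 2 - nu) * (m + n)%:R ^+ nu.+1)).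
  have FS : has_sum
      (fun p => \sum_(2 <= nu < k.+2) (nu%:R : R[i]) *: f nu p) (s1 : R[i]^o).
    apply: has_sum_sum => nu; rewrite mem_index_iota => nuk.
    by apply: has_sumZ; have [l /has_sum_dsum []] := Snu nu nuk.
  (* Termwise, the first three families add up to F(m, n) - F(m + n, n), and the [T4] family
     restores F(m + n, n). *)
  apply: eq_has_sum (has_sumD (has_sumD
    (has_sumD FS (has_sumZ (a := (k + 1)%:R) T1P)) T2P) T4P) => -[m n].
  have natS0 j : j.+1%:R != 0 :> R[i] by rewrite pnatr_eq0.
  have := sum_partial_fractions k (natS0 m) (natS0 n).
  rewrite -natrD addSn => /(_ (natS0 _)) pf.
  rewrite /f /shift_pair /F /= natrM !natrX addSn.
  under eq_bigr do rewrite [_ *: _]mulrCA.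
  rewrite -mulr_sumr [_ *: _]mulrCA -!mulrDr pf; congr (_ * _).
  by rewrite !invfM [X in X + _]mulrC -mulrDr subrK.
(* Both values of the sum contain [T4]; cancelling it leaves [s4 + s5] equal to the first three
   contributions. *)
have := has_sum_unique F1 F2; rewrite [RHS]addrC -addrA => /addrI <-.
by rewrite [LHS]addrC; apply: addKr.
Qed.
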